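(* Let $L\colon\mathsf{A}\rightleftarrows\mathsf{X}\colon R$ be an adjunction between topoi, $L$ left adjoint to $R$, with $L$ preserving pullbacks. Given four fine rewrites of structured cospans $$\alpha=\begin{array}{ccccc}La&\to&u&\leftarrow&Lb\\ \uparrow&&\uparrow&&\uparrow\\ Ld&\to&w&\leftarrow&Le\\ \downarrow&&\downarrow&&\downarrow\\ Lg&\to&y&\leftarrow&Lh\end{array}\qquad \alpha'=\begin{array}{ccccc}Lb&\to&v&\leftarrow&Lc\\ \uparrow&&\uparrow&&\uparrow\\ Le&\to&x&\leftarrow&Lf\\ \downarrow&&\downarrow&&\downarrow\\ Lh&\to&z&\leftarrow&Li\end{array}$$ $$\beta=\begin{array}{ccccc}Lg&\to&y&\leftarrow&Lh\\ \uparrow&&\uparrow&&\uparrow\\ Ld'&\to&w'&\leftarrow&Le'\\ \downarrow&&\downarrow&&\downarrow\\ La'&\to&u'&\leftarrow&Lb'\end{array}\qquad \beta'=\begin{array}{ccccc}Lh&\to&z&\leftarrow&Li\\ \uparrow&&\uparrow&&\uparrow\\ Le'&\to&x'&\leftarrow&Lf'\\ \downarrow&&\downarrow&&\downarrow\\ Lb'&\to&v'&\leftarrow&Lc'\end{array}$$ (whose shared rows and columns coincide), it is true that $$(\alpha\circ_{\mathrm h}\alpha')\circ_{\mathrm v}(\beta\circ_{\mathrm h}\beta')=(\alpha\circ_{\mathrm v}\beta)\circ_{\mathrm h}(\alpha'\circ_{\mathrm v}\beta').$$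
   Context: A topos is a category with finite limits that is cartesian closed and has a subobject classifier. A structured cospan is a cospan $La\to x\leftarrow Lb$ in $\mathsf{X}$ with $a,b$ objects of $\mathsf{A}$. A span of structured cospans is a commuting $3\times3$ diagram in $\mathsf{X}$ of the displayed shape: its three rows are structured cospans and its columns are spans with apex in the middle row. An isomorphism from a span of structured cospans with central object $y$ to another that agrees with it except that its central object is $y'$ (with its own arrows to and from the unchanged objects) is an invertible arrow $\theta\colon y\to y'$ commuting with the arrows from the two middle feet and with the arrows to the top and bottom central objects. A fine rewrite of structured cospans is an isomorphism class of spans of structured cospans whose outer vertical arrows are isomorphisms and whose two central vertical arrows (out of the central object) are monic. Equality in the claim is equality of fine rewrites. Horizontal composition $\circ_{\mathrm h}$ is by pushout in each row: rows $La\to v\leftarrow La'$ and $La'\to v'\leftarrow La''$ give $La\to v+_{La'}v'\leftarrow La''$, with the induced vertical arrows. Vertical composition $\circ_{\mathrm v}$ (first factor on top) of a square with middle row $Lb\to w\leftarrow Lb'$ and bottom row $Lc\to x\leftarrow Lc'$ with a square with top row $Lc\to x\leftarrow Lc'$ and middle row $Ld\to y\leftarrow Ld'$ has the top row of the first, the bottom row of the second, and middle row $L(b\times_c d)\to w\times_x y\leftarrow L(b'\times_{c'}d')$, where $L(b\times_c d)$ is the pullback of $Lb$ and $Ld$ over $Lc$, as $L$ preserves pullbacks. *)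

(* Defs.v *)
From Corelib Require Import ssreflect.
From Stdlib Require Import List IndefiniteDescription FunctionalExtensionality
  PropExtensionality ProofIrrelevance.

Set Implicit Arguments.
Unset Strict Implicit.
Unset Printing Implicit Defensive.

Declare Scope cat_scope.
Delimit Scope cat_scope with cat.
Local Open Scope cat_scope.

(** * Categories, functors, adjunctions *)

Record category := Category {
  ob :> Type;
  hom : ob -> ob -> Type;
  idm : forall a, hom a a;
  comp : forall a b c, hom b c -> hom a b -> hom a c;
  comp1m : forall a b (f : hom a b), comp (idm b) f = f;
  compm1 : forall a b (f : hom a b), comp f (idm a) = f;
  compA : forall a b c d (h : hom c d) (g : hom b c) (f : hom a b),
    comp h (comp g f) = comp (comp h g) f }.

Arguments hom {c} a b : rename.
Arguments idm {c} a : rename.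
Arguments comp {c a b c} g f : rename.
Notation "g \o f" := (comp g f) (at level 50, left associativity) : cat_scope.

Record functor (C D : category) := Functor {
  fob :> C -> D;
  fmap : forall a b, hom a b -> hom (fob a) (fob b);
  fmap1 : forall a, fmap (idm a) = idm (fob a);
  fmapM : forall a b c (g : hom b c) (f : hom a b),
    fmap (g \o f) = fmap g \o fmap f }.

Arguments fmap {C D} F {a b} f : rename.

Record adjunction (A X : category) (L : functor A X) (R : functor X A) :=
  Adjunction {
    unit_ : forall a : A, hom a (R (L a));
    counit_ : forall x : X, hom (L (R x)) x;
    unit_nat : forall (a b : A) (f : hom a b),
      fmap R (fmap L f) \o unit_ a = unit_ b \o f;
    counit_nat : forall (x y : X) (f : hom x y),
      f \o counit_ x = counit_ y \o fmap L (fmap R f);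
    triangle_l : forall a : A, counit_ (L a) \o fmap L (unit_ a) = idm (L a);
    triangle_r : forall x : X, fmap R (counit_ x) \o unit_ (R x) = idm (R x) }.

Definition is_iso (C : category) (a b : C) (f : hom a b) : Prop :=
  exists g : hom b a, g \o f = idm a /\ f \o g = idm b.

Definition is_mono (C : category) (a b : C) (f : hom a b) : Prop :=
  forall (z : C) (u v : hom z a), f \o u = f \o v -> u = v.

Definition is_epi (C : category) (a b : C) (f : hom a b) : Prop :=
  forall (z : C) (u v : hom b z), u \o f = v \o f -> u = v.

Definition the (T : Type) (P : T -> Prop) (e : exists! x, P x) : T :=
  proj1_sig (constructive_definite_description P e).

Lemma theP (T : Type) (P : T -> Prop) (e : exists! x, P x) : P (the e).
Proof. exact: proj2_sig. Qed.

(** * Pullbacks and pushouts *)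

Definition is_pullback (C : category) (p a b c : C)
    (p1 : hom p a) (p2 : hom p b) (f : hom a c) (g : hom b c) : Prop :=
  f \o p1 = g \o p2 /\
  forall (z : C) (u : hom z a) (v : hom z b), f \o u = g \o v ->
    exists! h : hom z p, p1 \o h = u /\ p2 \o h = v.

Definition is_pushout (C : category) (c a b d : C)
    (f : hom c a) (g : hom c b) (i : hom a d) (j : hom b d) : Prop :=
  i \o f = j \o g /\
  forall (z : C) (u : hom a z) (v : hom b z), u \o f = v \o g ->
    exists! h : hom d z, h \o i = u /\ h \o j = v.

Record pullback (C : category) (a b c : C) (f : hom a c) (g : hom b c) :=
  Pullback {
    pb_ob :> C;
    pb_fst : hom pb_ob a;
    pb_snd : hom pb_ob b;
    pbP : is_pullback pb_fst pb_snd f g }.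

Record pushout (C : category) (c a b : C) (f : hom c a) (g : hom c b) :=
  Pushout {
    po_ob :> C;
    po_inl : hom a po_ob;
    po_inr : hom b po_ob;
    poP : is_pushout f g po_inl po_inr }.

(* Choices of all pullbacks and pushouts; a topos has both, see
   [topos_pullbacks] and [topos_pushouts]. *)
Definition pullbacks (C : category) :=
  forall (a b c : C) (f : hom a c) (g : hom b c), pullback f g.

Definition pushouts (C : category) :=
  forall (c a b : C) (f : hom c a) (g : hom c b), pushout f g.

Definition pb_pair (C : category) (a b c : C) (f : hom a c) (g : hom b c)
    (P : pullback f g) (z : C) (u : hom z a) (v : hom z b)
    (e : f \o u = g \o v) : hom z P :=
  the (proj2 (pbP P) z u v e).

Definition po_copair (C : category) (c a b : C) (f : hom c a) (g : hom c b)
    (P : pushout f g) (z : C) (u : hom a z) (v : hom b z)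
    (e : u \o f = v \o g) : hom P z :=
  the (proj2 (poP P) z u v e).

Definition preserves_pullbacks (C D : category) (F : functor C D) : Prop :=
  forall (p a b c : C) (p1 : hom p a) (p2 : hom p b) (f : hom a c)
    (g : hom b c),
  is_pullback p1 p2 f g ->
  is_pullback (fmap F p1) (fmap F p2) (fmap F f) (fmap F g).

(** * Topoi *)

Definition finite_type (T : Type) : Prop :=
  exists s : list T, forall x : T, In x s.

Definition finite_category (J : category) : Prop :=
  finite_type J /\ forall i j : J, finite_type (hom i j).

Record cone (J C : category) (D : functor J C) := Cone {
  apex :> C;
  leg : forall j : J, hom apex (D j);
  leg_nat : forall (i j : J) (f : hom i j), fmap D f \o leg i = leg j }.

Arguments leg {J C D} K j : rename.

Definition is_limit (J C : category) (D : functor J C) (K : cone D) : Prop :=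
  forall K' : cone D,
    exists! h : hom K' K, forall j : J, leg K j \o h = leg K' j.

Definition has_finite_limits (C : category) : Prop :=
  forall (J : category) (D : functor J C), finite_category J ->
    exists K : cone D, is_limit K.

Definition is_terminal (C : category) (t : C) : Prop :=
  forall a : C, exists! f : hom a t, True.

Record product (C : category) (a b : C) := Product {
  pr_ob :> C;
  pr1 : hom pr_ob a;
  pr2 : hom pr_ob b;
  prP : forall (z : C) (u : hom z a) (v : hom z b),
    exists! h : hom z pr_ob, pr1 \o h = u /\ pr2 \o h = v }.

Arguments pr1 {C a b} P : rename.
Arguments pr2 {C a b} P : rename.

Definition pair (C : category) (a b : C) (P : product a b) (z : C)
    (u : hom z a) (v : hom z b) : hom z P := the (prP P u v).

(* [b^a] with its evaluation [b^a * a -> b], the universal property being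
   tested against every product [z * a]. *)
Record exponential (C : category) (a b : C) := Exponential {
  exp_ob :> C;
  exp_prod : product exp_ob a;
  exp_ev : hom exp_prod b;
  expP : forall (z : C) (Q : product z a) (f : hom Q b),
    exists! g : hom z exp_ob,
      exp_ev \o pair exp_prod (g \o pr1 Q) (pr2 Q) = f }.

Arguments exp_prod {C a b} E : rename.
Arguments exp_ev {C a b} E : rename.
Arguments expP {C a b} E {z Q} f : rename.

Definition cartesian_closed (C : category) : Prop :=
  (exists t : C, is_terminal t) /\
  (forall a b : C, inhabited (product a b)) /\
  (forall a b : C, inhabited (exponential a b)).

Definition has_subobject_classifier (C : category) : Prop :=
  exists (t omega : C) (tru : hom t omega),
    is_terminal t /\
    forall (s a : C) (m : hom s a), is_mono m ->
      exists! chi : hom a omega,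
        exists bang : hom s t, is_pullback m bang chi tru.

Definition is_topos (C : category) : Prop :=
  has_finite_limits C /\ cartesian_closed C /\ has_subobject_classifier C.

(** * Elementary facts *)

Section Elementary.
Context (C : category).

Lemma pb_comm (a b c : C) (f : hom a c) (g : hom b c) (P : pullback f g) :
  f \o pb_fst P = g \o pb_snd P.
Proof. exact: (proj1 (pbP P)). Qed.

Lemma po_comm (c a b : C) (f : hom c a) (g : hom c b) (P : pushout f g) :
  po_inl P \o f = po_inr P \o g.
Proof. exact: (proj1 (poP P)). Qed.

Lemma pb_pair_fst (a b c : C) (f : hom a c) (g : hom b c) (P : pullback f g)
    z (u : hom z a) (v : hom z b) e : pb_fst P \o pb_pair P (u:=u) (v:=v) e = u.
Proof. exact: (proj1 (theP (proj2 (pbP P) z u v e))). Qed.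

Lemma pb_pair_snd (a b c : C) (f : hom a c) (g : hom b c) (P : pullback f g)
    z (u : hom z a) (v : hom z b) e : pb_snd P \o pb_pair P (u:=u) (v:=v) e = v.
Proof. exact: (proj2 (theP (proj2 (pbP P) z u v e))). Qed.

Lemma is_pb_inj (p a b c : C) (p1 : hom p a) (p2 : hom p b) (f : hom a c)
    (g : hom b c) : is_pullback p1 p2 f g ->
  forall z (h k : hom z p), p1 \o h = p1 \o k -> p2 \o h = p2 \o k -> h = k.
Proof.
move=> [e U] z h k e1 e2.
have e3 : f \o (p1 \o k) = g \o (p2 \o k) by rewrite !compA e.
have [w [_ Uw]] := U _ _ _ e3.
by rewrite -(Uw h (conj e1 e2)) (Uw k (conj eq_refl eq_refl)).
Qed.

Lemma pb_inj (a b c : C) (f : hom a c) (g : hom b c) (P : pullback f g)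
    z (h k : hom z P) :
  pb_fst P \o h = pb_fst P \o k -> pb_snd P \o h = pb_snd P \o k -> h = k.
Proof. exact: (is_pb_inj (pbP P)). Qed.

Lemma po_copair_inl (c a b : C) (f : hom c a) (g : hom c b) (P : pushout f g)
    z (u : hom a z) (v : hom b z) e :
  po_copair P (u:=u) (v:=v) e \o po_inl P = u.
Proof. exact: (proj1 (theP (proj2 (poP P) z u v e))). Qed.

Lemma po_copair_inr (c a b : C) (f : hom c a) (g : hom c b) (P : pushout f g)
    z (u : hom a z) (v : hom b z) e :
  po_copair P (u:=u) (v:=v) e \o po_inr P = v.
Proof. exact: (proj2 (theP (proj2 (poP P) z u v e))). Qed.

Lemma is_po_inj (c a b d : C) (f : hom c a) (g : hom c b) (i : hom a d)
    (j : hom b d) : is_pushout f g i j ->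
  forall z (h k : hom d z), h \o i = k \o i -> h \o j = k \o j -> h = k.
Proof.
move=> [e U] z h k e1 e2.
have e3 : (k \o i) \o f = (k \o j) \o g by rewrite -!compA e.
have [w [_ Uw]] := U _ _ _ e3.
by rewrite -(Uw h (conj e1 e2)) (Uw k (conj eq_refl eq_refl)).
Qed.

Lemma po_inj (c a b : C) (f : hom c a) (g : hom c b) (P : pushout f g)
    z (h k : hom P z) :
  h \o po_inl P = k \o po_inl P -> h \o po_inr P = k \o po_inr P -> h = k.
Proof. exact: (is_po_inj (poP P)). Qed.

Lemma is_po_sym (c a b d : C) (f : hom c a) (g : hom c b) (i : hom a d)
    (j : hom b d) : is_pushout f g i j -> is_pushout g f j i.
Proof.
move=> [e U]; split=> // z u v e'.
have [h [[h1 h2] Uh]] := U z v u (eq_sym e').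
by exists h; split=> // k [k1 k2]; apply: Uh.
Qed.

Lemma pair1 (a b : C) (P : product a b) z (u : hom z a) (v : hom z b) :
  pr1 P \o pair P u v = u.
Proof. exact: (proj1 (theP (prP P u v))). Qed.

Lemma pair2 (a b : C) (P : product a b) z (u : hom z a) (v : hom z b) :
  pr2 P \o pair P u v = v.
Proof. exact: (proj2 (theP (prP P u v))). Qed.

Lemma pr_inj (a b : C) (P : product a b) z (h k : hom z P) :
  pr1 P \o h = pr1 P \o k -> pr2 P \o h = pr2 P \o k -> h = k.
Proof.
move=> e1 e2; have [w [_ U]] := prP P (pr1 P \o k) (pr2 P \o k).
by rewrite -(U h (conj e1 e2)) (U k (conj eq_refl eq_refl)).
Qed.

Lemma pair_comp (a b : C) (P : product a b) z w (u : hom z a) (v : hom z b)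
    (t : hom w z) : pair P u v \o t = pair P (u \o t) (v \o t).
Proof. by apply: pr_inj; rewrite compA ?pair1 ?pair2. Qed.

Lemma mono_comp (a b c : C) (g : hom b c) (f : hom a b) :
  is_mono g -> is_mono f -> is_mono (g \o f).
Proof. by move=> mg mf z u v; rewrite -!compA => /mg/mf. Qed.

Lemma iso_comp (a b c : C) (g : hom b c) (f : hom a b) :
  is_iso g -> is_iso f -> is_iso (g \o f).
Proof.
move=> [g' [g1 g2]] [f' [f1 f2]]; exists (f' \o g'); split.
  by rewrite compA -(compA f') g1 compm1.
by rewrite compA -(compA g) f2 compm1.
Qed.

Lemma iso_mono (a b : C) (f : hom a b) : is_iso f -> is_mono f.
Proof.
move=> [g [gf _]] z u v e.
by rewrite -(comp1m u) -(comp1m v) -gf -!compA e.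
Qed.

Lemma iso_epi (a b : C) (f : hom a b) : is_iso f -> is_epi f.
Proof.
move=> [g [_ fg]] z u v e.
by rewrite -(compm1 u) -(compm1 v) -fg !compA e.
Qed.

Lemma iso_id (a : C) : is_iso (idm a).
Proof. by exists (idm a); rewrite comp1m. Qed.

Lemma pb_mono_fst (p a b c : C) (p1 : hom p a) (p2 : hom p b) (f : hom a c)
    (g : hom b c) : is_pullback p1 p2 f g -> is_mono g -> is_mono p1.
Proof.
move=> H mg z u v e; apply: (is_pb_inj H) => //; apply: mg.
by rewrite !compA -(proj1 H) -!compA e.
Qed.

Lemma pb_mono_snd (p a b c : C) (p1 : hom p a) (p2 : hom p b) (f : hom a c)
    (g : hom b c) : is_pullback p1 p2 f g -> is_mono f -> is_mono p2.
Proof.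
move=> H mf z u v e; apply: (is_pb_inj H) => //; apply: mf.
by rewrite !compA (proj1 H) -!compA e.
Qed.

Lemma pb_iso_fst (p a b c : C) (p1 : hom p a) (p2 : hom p b) (f : hom a c)
    (g : hom b c) : is_pullback p1 p2 f g -> is_iso g -> is_iso p1.
Proof.
move=> H ig; have mg := iso_mono ig; case: (ig) => g' [_ gg'].
have e : f \o idm a = g \o (g' \o f) by rewrite compA gg' comp1m compm1.
have [h [[h1 _] _]] := proj2 H _ _ _ e.
exists h; split=> //; apply: (pb_mono_fst H mg).
by rewrite compA h1 comp1m compm1.
Qed.

Lemma is_pb_sym (p a b c : C) (p1 : hom p a) (p2 : hom p b) (f : hom a c)
    (g : hom b c) : is_pullback p1 p2 f g -> is_pullback p2 p1 g f.
Proof.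
move=> [e U]; split=> // z u v e'.
have [h [[h1 h2] Uh]] := U z v u (eq_sym e').
by exists h; split=> // k [k1 k2]; apply: Uh.
Qed.

Lemma pb_iso_snd (p a b c : C) (p1 : hom p a) (p2 : hom p b) (f : hom a c)
    (g : hom b c) : is_pullback p1 p2 f g -> is_iso f -> is_iso p2.
Proof. by move/is_pb_sym; apply: pb_iso_fst. Qed.

End Elementary.

(** * Pullbacks and pushouts in a topos *)

Lemma inhabited_choice (T : Type) : inhabited T -> T.
Proof.
move=> i; have e : exists x : T, True by case: i => x; exists x.
by case: (constructive_indefinite_description _ e).
Qed.

Inductive corner := CornerL | CornerR | CornerM.

Definition corner_hom (x y : corner) : Type :=
  match x, y with
  | CornerL, CornerL | CornerR, CornerR | CornerM, CornerM
  | CornerL, CornerM | CornerR, CornerM => unit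
  | _, _ => Empty_set
  end.

Definition corner_cat : category.
Proof.
refine (@Category corner corner_hom
  (fun x => match x with CornerL => tt | CornerR => tt | CornerM => tt end)
  _ _ _ _).
Unshelve.
4: by case; case; case=> //= _ _; exact: tt.
all: repeat case; done.
Defined.

Definition corner_functor (C : category) (a b c : C) (f : hom a c)
  (g : hom b c) : functor corner_cat C.
Proof.
refine (@Functor corner_cat C
  (fun x => match x with CornerL => a | CornerR => b | CornerM => c end)
  (fun x y => match x, y return corner_hom x y -> hom
       match x with CornerL => a | CornerR => b | CornerM => c end
       match y with CornerL => a | CornerR => b | CornerM => c end with
     | CornerL, CornerL => fun _ => idm a
     | CornerR, CornerR => fun _ => idm b
     | CornerM, CornerM => fun _ => idm c
     | CornerL, CornerM => fun _ => f
     | CornerR, CornerM => fun _ => g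
     | CornerL, CornerR | CornerR, CornerL
     | CornerM, CornerL | CornerM, CornerR => fun e => match e with end
     end) _ _).
- by case.
- by case; case; case=> //= _ _; rewrite ?comp1m ?compm1.
Defined.

Lemma corner_finite : finite_category corner_cat.
Proof.
split; first by exists (CornerL :: CornerR :: CornerM :: nil); case=> /=; auto.
case; case; (exists (tt :: nil) || exists nil); case=> /=; auto.
Qed.

Lemma finite_limits_pullbacks (C : category) :
  has_finite_limits C -> inhabited (pullbacks C).
Proof.
move=> H; constructor=> a b c f g; apply: inhabited_choice.
have [K KP] := H _ (corner_functor f g) corner_finite.
have eL : f \o (leg K CornerL : hom K a) = leg K CornerM :> hom K c :=
  @leg_nat _ _ _ K CornerL CornerM tt.
have eR : g \o (leg K CornerR : hom K b) = leg K CornerM :> hom K c :=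
  @leg_nat _ _ _ K CornerR CornerM tt.
constructor; refine (@Pullback _ _ _ _ f g K (leg K CornerL : hom K a)
  (leg K CornerR : hom K b) _); split.
  by etransitivity; [exact: eL | symmetry; exact: eR].
move=> z u v e.
pose l (i : corner_cat) : hom z (corner_functor f g i) :=
  match i with CornerL => u | CornerR => v | CornerM => f \o u end.
have nat (i j : corner_cat) (k : hom i j) :
    fmap (corner_functor f g) k \o l i = l j.
  by case: i j k; case=> //= _; rewrite ?comp1m.
have [h [hP hU]] := KP (Cone nat); exists h; split.
  by split; [exact: (hP CornerL) | exact: (hP CornerR)].
move=> k [k1 k2]; apply: hU; case=> //=.
etransitivity; first by apply: (f_equal (fun x => x \o k)); symmetry; exact: eL.
by rewrite -compA /= k1.
Qed.

Lemma topos_pullbacks (C : category) : is_topos C -> inhabited (pullbacks C).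
Proof. by case=> /finite_limits_pullbacks. Qed.

Section Topos.
Context (C : category) (pbk : pullbacks C).
Context (prd : forall a b : C, product a b).
Context (t omega : C) (tru : hom t omega) (tP : is_terminal t).
Context (omegaP : forall (s a : C) (m : hom s a), is_mono m ->
  exists! chi : hom a omega, exists bang : hom s t, is_pullback m bang chi tru).
Context (pow : forall a : C, exponential a omega).

Let bang (a : C) : hom a t := the (tP a).

Let bang_eq (a : C) (f g : hom a t) : f = g.
Proof. by have [h [_ U]] := tP a; rewrite -(U f I) (U g I). Qed.

(* [phi : z -> omega] read as a truth value at stage [z]. *)
Let holds (z : C) (phi : hom z omega) : Prop := phi = tru \o bang z.

Let holds_comp z w (phi : hom z omega) (u : hom w z) :
  holds phi -> holds (phi \o u).
Proof. by rewrite /holds => ->; rewrite -compA (bang_eq (_ \o u) (bang w)). Qed.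

Let tru_mono : is_mono tru.
Proof. by move=> z u v _; apply: bang_eq. Qed.

Let is_pb_holds z s (phi : hom z omega) (m : hom s z) :
  (forall w (u : hom w z), holds (phi \o u) <-> exists v, m \o v = u) ->
  is_mono m -> is_pullback m (bang s) phi tru.
Proof.
move=> H mm; split.
  by apply/(H _ m); exists (idm s); rewrite compm1.
move=> w u v e.
have /H[h hu] : holds (phi \o u) by rewrite /holds e (bang_eq v (bang w)).
exists h; split; first by split=> //; apply: bang_eq.
by move=> k [k1 _]; apply: mm; rewrite hu.
Qed.

Let omega_ext z (phi psi : hom z omega) :
  (forall w (u : hom w z), holds (phi \o u) <-> holds (psi \o u)) -> phi = psi.
Proof.
move=> H; pose P := pbk phi tru.
have mm : is_mono (pb_fst P) := pb_mono_fst (pbP P) tru_mono.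
have HP w (u : hom w z) : holds (phi \o u) <-> exists v, pb_fst P \o v = u.
  split=> [h|[v <-]]; last first.
    by rewrite compA pb_comm -compA /holds (bang_eq (_ \o v) (bang w)).
  by exists (pb_pair P (u:=u) (v:=bang w) h); rewrite pb_pair_fst.
have [chi [_ U]] := omegaP mm.
have e1 : chi = phi by apply: U; exists (bang P); apply: is_pb_holds.
have e2 : chi = psi.
  by apply: U; exists (bang P); apply: is_pb_holds => // w u; rewrite -H.
by rewrite -e1 e2.
Qed.

Let classify s a (m : hom s a) : is_mono m ->
  exists chi : hom a omega,
    forall w (u : hom w a), holds (chi \o u) <-> exists v, m \o v = u.
Proof.
move=> mm; have [chi [[b [e U]] _]] := omegaP mm; exists chi => w u; split.
  by move=> /U[h [[h1 _] _]]; exists h.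
by move=> [v <-]; rewrite compA e -compA /holds (bang_eq (_ \o v) (bang w)).
Qed.

Lemma topos_balanced (a b : C) (f : hom a b) :
  is_mono f -> is_epi f -> is_iso f.
Proof.
move=> mf ef; have [chi chiP] := classify mf.
have e : chi = tru \o bang b.
  apply: ef; have /chiP -> : exists v, f \o v = f by exists (idm a); rewrite compm1.
  by rewrite -compA (bang_eq (bang b \o f) (bang a)).
have /chiP[g fg] : holds (chi \o idm b) by rewrite compm1.
exists g; split=> //; apply: mf; by rewrite compA fg comp1m compm1.
Qed.

(** Generalized elements of power objects. *)

Let isin z a (x : hom z a) (S : hom z (pow a)) : Prop :=
  holds (exp_ev (pow a) \o pair (exp_prod (pow a)) S x).

Let isin_comp z w a (x : hom z a) (S : hom z (pow a)) (u : hom w z) :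
  isin x S -> isin (x \o u) (S \o u).
Proof. by rewrite /isin -pair_comp compA; apply: holds_comp. Qed.

Let pow_ext z a (S T : hom z (pow a)) :
  (forall w (u : hom w z) (x : hom w a), isin x (S \o u) <-> isin x (T \o u)) ->
  S = T.
Proof.
move=> H; pose Q := prd z a.
pose ev R := exp_ev (pow a) \o pair (exp_prod (pow a)) (R \o pr1 Q) (pr2 Q).
have e : ev S = ev T.
  apply: omega_ext => w u.
  rewrite /ev -!compA !pair_comp -!compA; exact: H.
have [R [_ U]] := expP (pow a) (ev T).
by rewrite -(U S e) (U T eq_refl).
Qed.

Let pow_map z a (rho : hom (prd z a) omega) :
  exists S : hom z (pow a), forall w (u : hom w z) (x : hom w a),
    isin x (S \o u) <-> holds (rho \o pair (prd z a) u x).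
Proof.
have [S [e _]] := expP (pow a) rho; exists S => w u x.
by rewrite -e -compA pair_comp -compA pair1 pair2.
Qed.

Let pow_sub z a s (m : hom s (prd z a)) : is_mono m ->
  exists S : hom z (pow a), forall w (u : hom w z) (x : hom w a),
    isin x (S \o u) <-> exists v, m \o v = pair (prd z a) u x.
Proof.
move=> /classify[chi chiP]; have [S SP] := pow_map chi; exists S => w u x.
by rewrite SP chiP.
Qed.

Let transp a k (e : hom k (pow a)) : exists! f : hom a (pow k),
  forall w (x : hom w a) (y : hom w k), isin y (f \o x) <-> isin x (e \o y).
Proof.
have [f fP] := pow_map
  (exp_ev (pow a) \o
     pair (exp_prod (pow a)) (e \o pr2 (prd a k)) (pr1 (prd a k))).
have H w (x : hom w a) (y : hom w k) : isin y (f \o x) <-> isin x (e \o y).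
  by rewrite fP -compA pair_comp -compA pair1 pair2.
by exists f; split=> // g gP; apply: pow_ext => w u y; rewrite H gP.
Qed.

Let tr a k (e : hom k (pow a)) : hom a (pow k) := the (transp e).

Let trP a k (e : hom k (pow a)) w (x : hom w a) (y : hom w k) :
  isin y (tr e \o x) <-> isin x (e \o y).
Proof. exact: (theP (transp e)). Qed.

Let eta a : hom a (pow (pow a)) := tr (idm (pow a)).

Let etaP a w (x : hom w a) (S : hom w (pow a)) :
  isin S (eta a \o x) <-> isin x S.
Proof. by rewrite trP comp1m. Qed.

(* inverse image *)
Let inv a b (f : hom a b) : hom (pow b) (pow a) := tr (eta b \o f).

Let invP a b (f : hom a b) w (x : hom w a) (S : hom w (pow b)) :
  isin x (inv f \o S) <-> isin (f \o x) S.
Proof. by rewrite trP -compA etaP. Qed.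

(* direct image along a mono splits inverse image *)
Let inv_split a b (m : hom a b) : is_mono m ->
  exists im : hom (pow a) (pow b), inv m \o im = idm (pow a).
Proof.
move=> mm; pose E := pbk (exp_ev (pow a)) tru.
pose Q := prd (pow a) b; pose n := pair Q (pr1 (exp_prod (pow a)))
                                        (m \o pr2 (exp_prod (pow a))).
have mn : is_mono (n \o pb_fst E).
  apply: mono_comp; last exact: pb_mono_fst (pbP E) tru_mono.
  move=> z u v e; apply: pr_inj.
    by have := f_equal (fun k => pr1 Q \o k) e; rewrite !compA pair1.
  apply: mm.
  by have := f_equal (fun k => pr2 Q \o k) e; rewrite !compA pair2.
have [im imP] := pow_sub mn; exists im; apply: pow_ext => w u x.
rewrite -compA invP imP comp1m; split.
  move=> [v e].
  have e1 := f_equal (fun k => pr1 Q \o k) e.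
  have e2 := f_equal (fun k => pr2 Q \o k) e.
  rewrite /n !compA !pair1 in e1; rewrite /n !compA !pair2 in e2.
  rewrite -!compA in e2; move/mm: e2 => e2.
  rewrite /isin -e1 -e2 -!compA.
  have -> : pair (exp_prod (pow a)) (pr1 (exp_prod (pow a)) \o (pb_fst E \o v))
      (pr2 (exp_prod (pow a)) \o (pb_fst E \o v)) = pb_fst E \o v.
    by apply: pr_inj; rewrite ?pair1 ?pair2.
  by rewrite compA pb_comm -compA /holds (bang_eq (_ \o v) (bang w)).
move=> h; exists (pb_pair E h); rewrite -compA pb_pair_fst.
by apply: pr_inj; rewrite /n !compA ?pair1 ?pair2 -?compA ?pair1 ?pair2.
Qed.

Let diag_mono a : is_mono (pair (prd a a) (idm a) (idm a)).
Proof.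
move=> z u v e; have := f_equal (fun k => pr1 (prd a a) \o k) e.
by rewrite !compA pair1 !comp1m.
Qed.

Let singleton a : exists s : hom a (pow a), forall w (x y : hom w a),
  isin y (s \o x) <-> x = y.
Proof.
have [s sP] := pow_sub (@diag_mono a); exists s => w x y; rewrite sP; split.
  move=> [v e].
  have := f_equal (fun k => pr1 (prd a a) \o k) e.
  have := f_equal (fun k => pr2 (prd a a) \o k) e.
  by rewrite !compA !pair1 !pair2 comp1m => <- <-.
by move=> <-; exists x; rewrite pair_comp comp1m.
Qed.

Let eta_mono a : is_mono (eta a).
Proof.
move=> z u v e; have [s sP] := singleton a.
suff : isin v (s \o u) by move/sP.
by rewrite -etaP -e etaP sP.
Qed.

Let inv_comp a b c (g : hom b c) (f : hom a b) : inv (g \o f) = inv f \o inv g.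
Proof.
by apply: pow_ext => w u x; rewrite -compA !invP compA.
Qed.

Let inv_faithful a b (f g : hom a b) : inv f = inv g -> f = g.
Proof.
move=> e; apply: eta_mono; apply: pow_ext => w u x.
by rewrite -!compA !etaP -!invP e.
Qed.

Lemma topos_mono_pushout (c a b d : C) (m : hom c a) (f : hom c b)
    (i : hom a d) (j : hom b d) :
  is_pushout m f i j -> is_mono m -> is_mono j.
Proof.
move=> [e U] mm; have [s sP] := singleton b.
have mg : is_mono (pair (prd a b) m f).
  move=> z u v e'; apply: mm.
  by have := f_equal (fun k => pr1 (prd a b) \o k) e'; rewrite !compA pair1.
have [g gP] := pow_sub mg.
have gs : g \o m = s \o f.
  apply: pow_ext => w u x; rewrite -!compA gP sP; split.
    move=> [v e'].
    have e1 := f_equal (fun k => pr1 (prd a b) \o k) e'.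
    have e2 := f_equal (fun k => pr2 (prd a b) \o k) e'.
    rewrite !compA !pair1 in e1; rewrite !compA !pair2 in e2.
    by rewrite -e2 (mm _ _ _ e1).
  by move=> <-; exists u; rewrite pair_comp.
have [h [[_ hj] _]] := U _ _ _ gs => z u v juv.
suff : isin v (s \o u) by move/sP.
by rewrite -hj -compA juv compA hj sP.
Qed.

(* [x] is the equalizer of [eta] and [inv (inv (eta x))] *)
Let eta_equalizer x z (s : hom z (pow (pow x))) :
  eta (pow (pow x)) \o s = inv (inv (eta x)) \o s ->
  exists h : hom z x, eta x \o h = s.
Proof.
move=> es; pose PP := pow (pow x).
pose u := pair (prd PP (pow (pow PP))) (idm PP) (eta PP).
pose v := pair (prd PP (pow (pow PP))) (idm PP) (inv (inv (eta x))).
pose E := pbk u v.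
have fs : pb_fst E = pb_snd E.
  have := f_equal (fun k => pr1 (prd PP (pow (pow PP))) \o k) (pb_comm E).
  by rewrite !compA !pair1 !comp1m.
have eE : eta PP \o pb_fst E = inv (inv (eta x)) \o pb_fst E.
  have := f_equal (fun k => pr2 (prd PP (pow (pow PP))) \o k) (pb_comm E).
  by rewrite !compA !pair2 -fs.
have lift w (k : hom w PP) : eta PP \o k = inv (inv (eta x)) \o k ->
    exists h : hom w E, pb_fst E \o h = k.
  move=> ek; have ek' : u \o k = v \o k by rewrite !pair_comp ek.
  by exists (pb_pair E ek'); rewrite pb_pair_fst.
have mE : is_mono (pb_fst E).
  by move=> w k l e; apply: pb_inj => //; rewrite -fs.
have eeta : eta PP \o eta x = inv (inv (eta x)) \o eta x.
  by apply: pow_ext => w k S; rewrite -!compA etaP invP etaP invP.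
have [r er] := lift _ _ eeta.
have tri y : inv (eta y) \o eta (pow y) = idm (pow y).
  by apply: pow_ext => w k S; rewrite -compA invP etaP etaP comp1m.
have ir1 : inv r \o (inv (pb_fst E) \o eta (pow x)) = idm (pow x).
  by rewrite compA -inv_comp er tri.
have ir2 : (inv (pb_fst E) \o eta (pow x)) \o inv r = idm (pow E).
  have [im imP] := inv_split mE.
  suff e : inv (pb_fst E) \o eta (pow x) \o inv r \o inv (pb_fst E) =
           inv (pb_fst E).
    by rewrite -[LHS]compm1 -imP compA e.
  rewrite -compA -inv_comp er; apply: pow_ext => w S k.
  by rewrite -!compA !invP etaP -invP compA -eE -compA etaP.
have ir_iso : is_iso (inv r) by exists (inv (pb_fst E) \o eta (pow x)).
have mr : is_mono r.
  by move=> w k l e; apply: (@eta_mono x); rewrite -er -!compA e.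
have epr : is_epi r.
  move=> w k l e; apply: inv_faithful; apply: (iso_mono ir_iso).
  by rewrite -!inv_comp e.
have [r' [_ rr']] := topos_balanced mr epr.
have [h hs] := lift _ _ es; exists (r' \o h).
by rewrite compA -er -(compA _ r) rr' compm1.
Qed.

Lemma topos_pushout_exists (c a b : C) (f : hom c a) (g : hom c b) :
  inhabited (pushout f g).
Proof.
pose K := pbk (inv f) (inv g); pose k1 := pb_fst K; pose k2 := pb_snd K.
pose i := tr k1; pose j := tr k2.
have ij : i \o f = j \o g.
  apply: pow_ext => w u S.
  by rewrite -!compA !trP -!invP !compA pb_comm.
have kij : inv f \o inv i = inv g \o inv j by rewrite -!inv_comp ij.
pose xi : hom (pow (pow K)) K := pb_pair K kij.
have k1xi : k1 \o xi = inv i by apply: pb_pair_fst.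
have k2xi : k2 \o xi = inv j by apply: pb_pair_snd.
pose PK := pow K; pose P3 := pow (pow PK); pose Q := prd PK P3.
pose u := pair Q (idm PK) (inv xi); pose v := pair Q (idm PK) (eta PK).
pose D := pbk u v; pose d := pb_fst D.
have fs : pb_fst D = pb_snd D.
  have := f_equal (fun k => pr1 Q \o k) (pb_comm D).
  by rewrite !compA !pair1 !comp1m.
have ed : inv xi \o d = eta PK \o d.
  have := f_equal (fun k => pr2 Q \o k) (pb_comm D).
  by rewrite !compA !pair2 -fs.
have lift w (k : hom w PK) : inv xi \o k = eta PK \o k ->
    exists h : hom w D, d \o h = k.
  move=> ek; have ek' : u \o k = v \o k by rewrite !pair_comp ek.
  by exists (pb_pair D ek'); rewrite pb_pair_fst.
have md : is_mono d.
  by move=> w k l e; apply: pb_inj => //; rewrite -fs.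
have [iD iDP] : exists h, d \o h = i.
  apply: lift; apply: pow_ext => w x S.
  by rewrite -!compA invP trP compA k1xi invP etaP.
have [jD jDP] : exists h, d \o h = j.
  apply: lift; apply: pow_ext => w x S.
  by rewrite -!compA invP trP compA k2xi invP etaP.
have ijD : iD \o f = jD \o g by apply: md; rewrite !compA iDP jDP.
(* [pow D] is [K] *)
have kD : inv f \o inv iD = inv g \o inv jD by rewrite -!inv_comp ijD.
pose io : hom (pow D) K := pb_pair K kD.
pose th : hom K (pow D) := inv d \o eta K.
have thxi : th \o xi = inv d.
  apply: pow_ext => w S x.
  by rewrite -!compA !invP etaP -invP compA ed -compA etaP.
have ioxi : io \o inv d = xi.
  apply: pb_inj; rewrite compA.
    by rewrite !pb_pair_fst -inv_comp iDP.
  by rewrite !pb_pair_snd -inv_comp jDP.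
have thio : th \o io = idm (pow D).
  have [im imP] := inv_split md.
  by rewrite -[LHS]compm1 -imP compA -(compA th) ioxi thxi.
constructor; refine (@Pushout _ _ _ _ f g D iD jD _); split=> // z p q pq.
have tpq : inv f \o inv p = inv g \o inv q by rewrite -!inv_comp pq.
pose tt : hom (pow z) K := pb_pair K tpq.
have [h hP] : exists h : hom D z, eta z \o h = inv tt \o d.
  apply: eta_equalizer; apply: pow_ext => w x S.
  have -> : isin S (eta (pow (pow z)) \o (inv tt \o d) \o x) <->
            isin (inv (inv tt) \o S) (eta PK \o d \o x).
    by rewrite -!compA !etaP invP.
  rewrite -ed -!compA !invP.
  suff -> : xi \o (inv (inv tt) \o S) = tt \o (inv (eta z) \o S) by [].
  rewrite !compA; congr (_ \o S); apply: pb_inj; rewrite !compA.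
    rewrite !pb_pair_fst -!inv_comp; congr inv; apply: pow_ext => y s W.
    by rewrite -!compA invP trP compA pb_pair_fst invP etaP.
  rewrite !pb_pair_snd -!inv_comp; congr inv; apply: pow_ext => y s W.
  by rewrite -!compA invP trP compA pb_pair_snd invP etaP.
have hi : h \o iD = p.
  apply: eta_mono; apply: pow_ext => y s W.
  rewrite !compA hP -!compA invP (compA d) iDP trP compA pb_pair_fst.
  by rewrite invP etaP.
have hj : h \o jD = q.
  apply: eta_mono; apply: pow_ext => y s W.
  rewrite !compA hP -!compA invP (compA d) jDP trP compA pb_pair_snd.
  by rewrite invP etaP.
exists h; split=> // l [li lj]; apply: inv_faithful.
have e : io \o inv h = io \o inv l.
  apply: pb_inj; rewrite !compA.
    by rewrite !pb_pair_fst -!inv_comp hi li.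
  by rewrite !pb_pair_snd -!inv_comp hj lj.
by rewrite -(comp1m (inv h)) -(comp1m (inv l)) -thio -!compA e.
Qed.

End Topos.

Lemma topos_pushouts (C : category) : is_topos C -> inhabited (pushouts C).
Proof.
move=> tC; constructor=> c a b f g; apply: inhabited_choice.
have [pbk] := topos_pullbacks tC.
have [_ [[_ [iprd ipow]] [t [omega [tru [tP omegaP]]]]]] := tC.
exact: (topos_pushout_exists pbk (fun a b => inhabited_choice (iprd a b)) tP
          omegaP (fun a => inhabited_choice (ipow a omega))).
Qed.

Lemma topos_is_pushout_mono (C : category) (c a b d : C) (m : hom c a)
    (f : hom c b) (i : hom a d) (j : hom b d) :
  is_topos C -> is_pushout m f i j -> is_mono m -> is_mono j.
Proof.
move=> tC; have [pbk] := topos_pullbacks tC.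
have [_ [[_ [iprd ipow]] [t [omega [tru [tP omegaP]]]]]] := tC.
exact: (topos_mono_pushout pbk (fun a b => inhabited_choice (iprd a b)) tP
          omegaP (fun a => inhabited_choice (ipow a omega))).
Qed.

Lemma topos_pushout_map_mono (C : category) (po : pushouts C)
    (e w x b u v : C) (f : hom e w) (g : hom e x) (f' : hom b u)
    (g' : hom b v) (k : hom e b) (m : hom w u) (n : hom x v)
    (h : hom (po _ _ _ f g) (po _ _ _ f' g')) :
  is_topos C -> is_iso k -> is_mono m -> is_mono n ->
  m \o f = f' \o k -> n \o g = g' \o k ->
  h \o po_inl (po _ _ _ f g) = po_inl (po _ _ _ f' g') \o m ->
  h \o po_inr (po _ _ _ f g) = po_inr (po _ _ _ f' g') \o n ->
  is_mono h.
Proof.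
move=> tC ik mm mn ef eg hl hr.
set P := po _ _ _ f g in h hl hr *; set Q := po _ _ _ f' g' in h hl hr *.
pose M := po _ _ _ (m \o f) g.
have ea : (po_inl M \o m) \o f = po_inr M \o g by rewrite -compA po_comm.
pose pa : hom P M := po_copair P ea.
have eb : po_inl Q \o (m \o f) = (po_inr Q \o n) \o g.
  by rewrite ef compA po_comm -!compA eg.
pose qb : hom M Q := po_copair M eb.
have Pa : is_pushout m (po_inl P) (po_inl M) pa.
  split=> [|z s t st]; first by rewrite po_copair_inl.
  have est : s \o (m \o f) = (t \o po_inr P) \o g.
    by rewrite compA st -compA po_comm compA.
  exists (po_copair M est); split.
    split; first exact: po_copair_inl.
    apply: po_inj; rewrite -compA.
      by rewrite po_copair_inl compA po_copair_inl.
    by rewrite po_copair_inr po_copair_inr.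
  move=> y [yl yr]; apply: po_inj; rewrite ?po_copair_inl ?po_copair_inr //.
  by rewrite -yr -compA po_copair_inr.
have Pb : is_pushout n (po_inr M) (po_inr Q) qb.
  split=> [|z s t st]; first by rewrite po_copair_inr.
  have est : (t \o po_inl M) \o f' = s \o g'.
    apply: (iso_epi ik).
    by rewrite -!compA -ef -eg po_comm !compA st.
  exists (po_copair Q est); split.
    split; first exact: po_copair_inr.
    apply: po_inj; rewrite -compA.
      by rewrite po_copair_inl po_copair_inl.
    by rewrite po_copair_inr compA po_copair_inr.
  move=> y [yr yl]; apply: po_inj; rewrite ?po_copair_inl ?po_copair_inr //.
  by rewrite -yl -compA po_copair_inl.
have pal : pa \o po_inl P = po_inl M \o m by apply: po_copair_inl.
have par : pa \o po_inr P = po_inr M by apply: po_copair_inr.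
have qbl : qb \o po_inl M = po_inl Q by apply: po_copair_inl.
have qbr : qb \o po_inr M = po_inr Q \o n by apply: po_copair_inr.
have -> : h = qb \o pa.
  apply: po_inj; first by rewrite hl -compA pal compA qbl.
  by rewrite hr -compA par qbr.
by apply: mono_comp; [apply: topos_is_pushout_mono tC Pb mn
                     |apply: topos_is_pushout_mono tC Pa mm].
Qed.

(** * Structured cospans and their rewrites *)

Section StructuredCospans.
Context (A X : category) (L : functor A X).

Record cospan (a b : A) := Cospan {
  csp_apex :> X;
  csp_left : hom (L a) csp_apex;
  csp_right : hom (L b) csp_apex }.

(* An outer column of a span of structured cospans: [L a <- L d -> L g]. *)
Record column (a g : A) := Column {
  col_mid : A;
  col_up : hom (L col_mid) (L a);
  col_down : hom (L col_mid) (L g) }.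

(* A span of structured cospans with prescribed top row [T], bottom row [B]
   and outer columns [l], [r].  Two such spans over the same [T], [B], [l],
   [r] agree except possibly in the central object and its arrows. *)
Record cell (a b g h : A) (T : cospan a b) (B : cospan g h)
    (l : column a g) (r : column b h) := Cell {
  mid :> X;
  mid_left : hom (L (col_mid l)) mid;
  mid_right : hom (L (col_mid r)) mid;
  mid_up : hom mid T;
  mid_down : hom mid B;
  cell_ul : mid_up \o mid_left = csp_left T \o col_up l;
  cell_ur : mid_up \o mid_right = csp_right T \o col_up r;
  cell_dl : mid_down \o mid_left = csp_left B \o col_down l;
  cell_dr : mid_down \o mid_right = csp_right B \o col_down r }.

Definition cell_iso (a b g h : A) (T : cospan a b) (B : cospan g h)
    (l : column a g) (r : column b h) (s s' : cell T B l r) : Prop :=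
  exists theta : hom s s',
    is_iso theta /\
    theta \o mid_left s = mid_left s' /\
    theta \o mid_right s = mid_right s' /\
    mid_up s' \o theta = mid_up s /\
    mid_down s' \o theta = mid_down s.

Definition fine_cell (a b g h : A) (T : cospan a b) (B : cospan g h)
    (l : column a g) (r : column b h) (s : cell T B l r) : Prop :=
  is_iso (col_up l) /\ is_iso (col_down l) /\
  is_iso (col_up r) /\ is_iso (col_down r) /\
  is_mono (mid_up s) /\ is_mono (mid_down s).

(* A fine rewrite is an isomorphism class, as a set of cells. *)
Record fine_rewrite (a b g h : A) (T : cospan a b) (B : cospan g h)
    (l : column a g) (r : column b h) := FineRewrite {
  fr_mem :> cell T B l r -> Prop;
  fr_class : exists s, fine_cell s /\ forall s', fr_mem s' <-> cell_iso s s' }.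

Section Cells.
Context (a b g h : A) (T : cospan a b) (B : cospan g h).
Context (l : column a g) (r : column b h).

Lemma cell_iso_refl (s : cell T B l r) : cell_iso s s.
Proof.
by exists (idm s); rewrite !comp1m !compm1; split=> //; apply: iso_id.
Qed.

Lemma cell_iso_sym (s s' : cell T B l r) : cell_iso s s' -> cell_iso s' s.
Proof.
move=> [th [[th' [e e']] [e1 [e2 [e3 e4]]]]]; exists th'.
rewrite -e1 -e2 -e3 -e4 !compA e !comp1m -!compA e' !compm1.
by split=> //; exists th.
Qed.

Lemma cell_iso_trans (s s' s'' : cell T B l r) :
  cell_iso s s' -> cell_iso s' s'' -> cell_iso s s''.
Proof.
move=> [th [i [e1 [e2 [e3 e4]]]]] [ch [i' [f1 [f2 [f3 f4]]]]].
exists (ch \o th); split; first exact: iso_comp.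
by rewrite -!compA e1 e2 f1 f2 !compA f3 f4.
Qed.

Lemma fine_rewrite_eq (x y : fine_rewrite T B l r) :
  (forall s, x s <-> y s) -> x = y.
Proof.
case: x y => [x xP] [y yP] /= e.
have exy : x = y.
  by apply: functional_extensionality => s; apply: propositional_extensionality.
by subst y; rewrite (proof_irrelevance _ xP yP).
Qed.

End Cells.

Section Horizontal.
Context (po : pushouts X).

Definition hrow (a b c : A) (T : cospan a b) (T' : cospan b c) : cospan a c :=
  let P := po (csp_right T) (csp_left T') in
  Cospan (po_inl P \o csp_left T) (po_inr P \o csp_right T').

Context (a b c g h i : A) (T : cospan a b) (T' : cospan b c).
Context (B : cospan g h) (B' : cospan h i).
Context (l : column a g) (m : column b h) (r : column c i).

Section Cell.
Context (s : cell T B l m) (s' : cell T' B' m r).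
Let P := po (mid_right s) (mid_left s').

Lemma hcell_up_comm :
  (po_inl (po (csp_right T) (csp_left T')) \o mid_up s) \o mid_right s =
  (po_inr (po (csp_right T) (csp_left T')) \o mid_up s') \o mid_left s'.
Proof. by rewrite -!compA cell_ur cell_ul !compA po_comm. Qed.

Lemma hcell_down_comm :
  (po_inl (po (csp_right B) (csp_left B')) \o mid_down s)
    \o mid_right s =
  (po_inr (po (csp_right B) (csp_left B')) \o mid_down s')
    \o mid_left s'.
Proof. by rewrite -!compA cell_dr cell_dl !compA po_comm. Qed.

Definition hcell : cell (hrow T T') (hrow B B') l r.
Proof.
refine (@Cell _ _ _ _ (hrow T T') (hrow B B') l r P
  (po_inl P \o mid_left s) (po_inr P \o mid_right s')
  (po_copair P hcell_up_comm) (po_copair P hcell_down_comm) _ _ _ _).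
- by rewrite compA po_copair_inl -compA cell_ul compA.
- by rewrite compA po_copair_inr -compA cell_ur compA.
- by rewrite compA po_copair_inl -compA cell_dl compA.
- by rewrite compA po_copair_inr -compA cell_dr compA.
Defined.

End Cell.

Lemma hcell_iso (s t : cell T B l m) (s' t' : cell T' B' m r) :
  cell_iso s t -> cell_iso s' t' -> cell_iso (hcell s s') (hcell t t').
Proof.
move=> [th [[ti [ti1 ti2]] [e1 [e2 [e3 e4]]]]].
move=> [ch [[ci [ci1 ci2]] [f1 [f2 [f3 f4]]]]].
pose P := po (mid_right s) (mid_left s').
pose Q := po (mid_right t) (mid_left t').
have eP : (po_inl Q \o th) \o mid_right s = (po_inr Q \o ch) \o mid_left s'.
  by rewrite -!compA e2 f1 po_comm.
have eQ : (po_inl P \o ti) \o mid_right t = (po_inr P \o ci) \o mid_left t'.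
  by rewrite -!compA -e2 -f1 (compA ti) ti1 (compA ci) ci1 !comp1m po_comm.
exists (po_copair P eP); split.
{ exists (po_copair Q eQ); split; apply: po_inj; rewrite -compA comp1m;
    rewrite ?po_copair_inl ?po_copair_inr compA
            ?po_copair_inl ?po_copair_inr -compA.
  - by rewrite ti1 compm1.
  - by rewrite ci1 compm1.
  - by rewrite ti2 compm1.
  - by rewrite ci2 compm1. }
rewrite /=; split; first by rewrite compA po_copair_inl -compA e1.
split; first by rewrite compA po_copair_inr -compA f2.
split; apply: po_inj; rewrite -compA ?po_copair_inl ?po_copair_inr;
  rewrite compA ?po_copair_inl ?po_copair_inr -compA.
- by rewrite e3.
- by rewrite f3.
- by rewrite e4.
- by rewrite f4.
Qed.

Lemma hcell_fine (tX : is_topos X) (s : cell T B l m) (s' : cell T' B' m r) :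
  fine_cell s -> fine_cell s' -> fine_cell (hcell s s').
Proof.
move=> [i1 [i2 [i3 [i4 [m1 m2]]]]] [_ [_ [i5 [i6 [m3 m4]]]]].
do 4!split=> //; split.
{ apply: (topos_pushout_map_mono tX i3 m1 m3) => /=.
  - exact: cell_ur.
  - exact: cell_ul.
  - exact: po_copair_inl.
  - exact: po_copair_inr. }
apply: (topos_pushout_map_mono tX i4 m2 m4) => /=.
- exact: cell_dr.
- exact: cell_dl.
- exact: po_copair_inl.
- exact: po_copair_inr.
Qed.

Definition hcomp (tX : is_topos X) (x : fine_rewrite T B l m)
    (x' : fine_rewrite T' B' m r) : fine_rewrite (hrow T T') (hrow B B') l r.
Proof.
exists (fun q => exists s s', x s /\ x' s' /\ cell_iso (hcell s s') q).
have [s [fs xs]] := fr_class x; have [s' [fs' xs']] := fr_class x'.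
exists (hcell s s'); split; first exact: hcell_fine.
move=> q; split; last first.
  move=> e; exists s, s'; split; first by apply/xs; apply: cell_iso_refl.
  by split=> //; apply/xs'; apply: cell_iso_refl.
move=> [t [t' [/xs e [/xs' e' eq]]]]; apply: cell_iso_trans eq.
exact: hcell_iso.
Defined.

End Horizontal.

(* An object [p] of [A], written [b *_c d], such that [L p] is the pullback of
   [L b] and [L d] over [L c].  The arrows of [X] between feet need not be
   images of arrows of [A]; when they are, and [L] preserves pullbacks, the
   pullback in [A] is one such object (see [foot_pullback_image]), and when
   they are invertible [b] itself is another (see [foot_pullback_iso]). *)
Record foot_pullback (b c d : A) (u : hom (L b) (L c)) (v : hom (L d) (L c)) :=
  FootPullback {
    fp_ob : A;
    fp_fst : hom (L fp_ob) (L b);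
    fp_snd : hom (L fp_ob) (L d);
    fpP : is_pullback fp_fst fp_snd u v }.

Definition foot_pullback_image (Lpb : preserves_pullbacks L) (b c d : A)
    (u : hom b c) (v : hom d c) (P : pullback u v) :
  foot_pullback (fmap L u) (fmap L v) :=
  FootPullback (Lpb _ _ _ _ _ _ _ _ (pbP P)).

Lemma foot_pullback_iso (b c d : A) (u : hom (L b) (L c))
    (v : hom (L d) (L c)) :
  is_iso v -> exists P : foot_pullback u v, fp_ob P = b.
Proof.
move=> [v' [v'v vv']].
have H : is_pullback (idm (L b)) (v' \o u) u v.
  split=> [|z p q e]; first by rewrite compA vv' comp1m compm1.
  exists p; split; last by move=> k [<- _]; rewrite comp1m.
  by rewrite comp1m -compA e compA v'v comp1m.
by exists (FootPullback H).
Qed.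

Section Vertical.
Context (pb : pullbacks X).

Definition vcol (a g a' : A) (l : column a g) (l' : column g a')
    (p : foot_pullback (col_down l) (col_up l')) : column a a' :=
  Column (col_up l \o fp_fst p) (col_down l' \o fp_snd p).

Context (a b g h a' b' : A) (T : cospan a b) (M : cospan g h).
Context (B : cospan a' b') (l : column a g) (r : column b h).
Context (l' : column g a') (r' : column h b').
Context (pl : foot_pullback (col_down l) (col_up l')).
Context (pr : foot_pullback (col_down r) (col_up r')).

Section Cell.
Context (s : cell T M l r) (s' : cell M B l' r').
Let P := pb (mid_down s) (mid_up s').

Lemma vcell_left_comm :
  mid_down s \o (mid_left s \o fp_fst pl) =
  mid_up s' \o (mid_left s' \o fp_snd pl).
Proof. by rewrite !compA cell_dl cell_ul -!compA (proj1 (fpP pl)). Qed.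

Lemma vcell_right_comm :
  mid_down s \o (mid_right s \o fp_fst pr) =
  mid_up s' \o (mid_right s' \o fp_snd pr).
Proof. by rewrite !compA cell_dr cell_ur -!compA (proj1 (fpP pr)). Qed.

Definition vcell : cell T B (vcol pl) (vcol pr).
Proof.
refine (@Cell _ _ _ _ T B (vcol pl) (vcol pr) P
  (pb_pair P vcell_left_comm) (pb_pair P vcell_right_comm)
  (mid_up s \o pb_fst P) (mid_down s' \o pb_snd P) _ _ _ _).
- by rewrite -compA pb_pair_fst compA cell_ul -compA.
- by rewrite -compA pb_pair_fst compA cell_ur -compA.
- by rewrite -compA pb_pair_snd compA cell_dl -compA.
- by rewrite -compA pb_pair_snd compA cell_dr -compA.
Defined.

End Cell.

Lemma vcell_iso (s t : cell T M l r) (s' t' : cell M B l' r') :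
  cell_iso s t -> cell_iso s' t' -> cell_iso (vcell s s') (vcell t t').
Proof.
move=> [th [[ti [ti1 ti2]] [e1 [e2 [e3 e4]]]]].
move=> [ch [[ci [ci1 ci2]] [f1 [f2 [f3 f4]]]]].
pose P := pb (mid_down s) (mid_up s').
pose Q := pb (mid_down t) (mid_up t').
have eP : mid_down t \o (th \o pb_fst P) = mid_up t' \o (ch \o pb_snd P).
  by rewrite !compA e4 f3 pb_comm.
have eQ : mid_down s \o (ti \o pb_fst Q) = mid_up s' \o (ci \o pb_snd Q).
  by rewrite -e4 -f3 -!compA !(compA th) !(compA ch) ti2 ci2 !comp1m pb_comm.
exists (pb_pair Q eP); split.
{ exists (pb_pair P eQ); split; apply: pb_inj; rewrite compA compm1;
    rewrite ?pb_pair_fst ?pb_pair_snd -compA ?pb_pair_fst ?pb_pair_snd compA.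
  - by rewrite ti1 comp1m.
  - by rewrite ci1 comp1m.
  - by rewrite ti2 comp1m.
  - by rewrite ci2 comp1m. }
rewrite /=; split.
  apply: pb_inj; rewrite compA ?pb_pair_fst ?pb_pair_snd -compA.
    by rewrite pb_pair_fst compA e1.
  by rewrite pb_pair_snd compA f1.
split.
  apply: pb_inj; rewrite compA ?pb_pair_fst ?pb_pair_snd -compA.
    by rewrite pb_pair_fst compA e2.
  by rewrite pb_pair_snd compA f2.
by rewrite -!compA pb_pair_fst pb_pair_snd !compA e3 f4.
Qed.

Lemma vcell_fine (s : cell T M l r) (s' : cell M B l' r') :
  fine_cell s -> fine_cell s' -> fine_cell (vcell s s').
Proof.
move=> [i1 [i2 [i3 [i4 [m1 m2]]]]] [j1 [j2 [j3 [j4 [n1 n2]]]]].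
split; first by apply: iso_comp => //; apply: pb_iso_fst (fpP pl) j1.
split; first by apply: iso_comp => //; apply: pb_iso_snd (fpP pl) i2.
split; first by apply: iso_comp => //; apply: pb_iso_fst (fpP pr) j3.
split; first by apply: iso_comp => //; apply: pb_iso_snd (fpP pr) i4.
split; apply: mono_comp => //=.
  exact: pb_mono_fst (pbP _) n1.
exact: pb_mono_snd (pbP _) m2.
Qed.

Definition vcomp (x : fine_rewrite T M l r) (x' : fine_rewrite M B l' r') :
  fine_rewrite T B (vcol pl) (vcol pr).
Proof.
exists (fun q => exists s s', x s /\ x' s' /\ cell_iso (vcell s s') q).
have [s [fs xs]] := fr_class x; have [s' [fs' xs']] := fr_class x'.
exists (vcell s s'); split; first exact: vcell_fine.
move=> q; split; last first.
  move=> e; exists s, s'; split; first by apply/xs; apply: cell_iso_refl.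
  by split=> //; apply/xs'; apply: cell_iso_refl.
move=> [t [t' [/xs e [/xs' e' eq]]]]; apply: cell_iso_trans eq.
exact: vcell_iso.
Defined.

End Vertical.
End StructuredCospans.

Arguments hrow {A X L} po {a b c} T T'.
Arguments hcomp {A X L} po {a b c g h i T T' B B' l m r} tX x x'.
Arguments vcol {A X L a g a' l l'} p.
Arguments vcomp {A X L} pb {a b g h a' b' T M B l r l' r'} pl pr x x'.

(* Main.v *)
(* Write P = y +_{Lh} z for the common middle row of the four squares.  Since
   the outer columns are invertible and the central arrows are monic, the two
   composites have as central objects two subobjects of P, namely
   (w /\ w') +_{Lh} (x /\ x') and (w +_{Lh} x) /\ (w' +_{Lh} x').  A classifier
   of w in y, extended to P by "true" on z, shows that w is the inverse image
   of w +_{Lh} x under y -> P; hence both subobjects have inverse image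
   w /\ w' in y, and likewise x /\ x' in z.  As y and z jointly cover P, their
   classifiers agree. *)

From Corelib Require Import ssreflect.
Require Import Defs.

Set Implicit Arguments.
Unset Strict Implicit.
Unset Printing Implicit Defensive.

Local Open Scope cat_scope.

(** * Subobjects of a pushout and their inverse images *)

Lemma terminal_eq (C : category) (t : C) :
  is_terminal t -> forall (a : C) (f g : hom a t), f = g.
Proof. by move=> tP a f g; have [h [_ U]] := tP a; rewrite -(U f I) (U g I). Qed.

(** A map to [y] and a map to [V] that agree over [P] lift to [w1] and to [w2]; the lifts agree over
    [y], hence combine into [A]. For monic [q1], [q2] this says that inverse image along [i]
    preserves intersections. *)
Lemma is_pb_meet (C : category) (y P w1 w2 Q1 Q2 A V : C)
    (i : hom y P) (q1 : hom Q1 P) (q2 : hom Q2 P)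
    (m1 : hom w1 y) (i1 : hom w1 Q1) (m2 : hom w2 y) (i2 : hom w2 Q2)
    (a1 : hom A w1) (a2 : hom A w2) (p1 : hom V Q1) (p2 : hom V Q2)
    (c : hom A V) :
  is_pullback m1 i1 i q1 -> is_pullback m2 i2 i q2 ->
  is_pullback a1 a2 m1 m2 -> is_pullback p1 p2 q1 q2 ->
  p1 \o c = i1 \o a1 -> p2 \o c = i2 \o a2 ->
  is_pullback (m1 \o a1) c i (q1 \o p1).
Proof.
move=> H1 H2 HA HV c1 c2; split.
  by rewrite compA (proj1 H1) -!compA c1.
move=> z u v e; rewrite -compA in e.
have e' : i \o u = q2 \o (p2 \o v) by rewrite e !compA (proj1 HV).
have [h1 [[h1u h1v] _]] := proj2 H1 _ _ _ e.
have [h2 [[h2u h2v] _]] := proj2 H2 _ _ _ e'.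
have [h [[hh1 hh2] _]] := proj2 HA _ h1 h2 (eq_trans h1u (eq_sym h2u)).
have hu : m1 \o a1 \o h = u by rewrite -compA hh1.
have hv : c \o h = v.
  apply: (is_pb_inj HV); rewrite compA.
    by rewrite c1 -compA hh1.
  by rewrite c2 -compA hh2.
exists h; split=> // k [ku kv].
have ek1 : a1 \o h = a1 \o k.
  apply: (is_pb_inj H1); first by rewrite !compA ku hu.
  by rewrite !compA -c1 -!compA kv hv.
apply: (is_pb_inj HA) => //; apply: (is_pb_inj H2).
  by rewrite !compA -(proj1 HA) -!compA ek1.
by rewrite !compA -c2 -!compA kv hv.
Qed.

Lemma topos_pushout_map_pullback (C : category) (e w x Q h y z P : C)
    (f' : hom e w) (g' : hom e x) (i' : hom w Q) (j' : hom x Q)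
    (f : hom h y) (g : hom h z) (i : hom y P) (j : hom z P)
    (k : hom e h) (m : hom w y) (n : hom x z) (q : hom Q P) :
  is_topos C -> is_pushout f' g' i' j' -> is_pushout f g i j ->
  is_epi k -> is_mono m -> is_mono q ->
  f \o k = m \o f' -> q \o i' = i \o m -> q \o j' = j \o n ->
  is_pullback m i' i q.
Proof.
move=> [_ [_ [t [om [tru [tP omP]]]]]] HQ HP ek mm mq ef ei ej.
have beq := terminal_eq tP; pose bang a : hom a t := the (tP a).
have [chi [[bw [cm U]] _]] := omP _ _ _ mm.
(* Both sides are true on [e], because [f \o k] factors through [m]; the epi [k] is then
   cancelled. *)
have cf : chi \o f = (tru \o bang z) \o g.
  apply: ek; rewrite -!compA ef compA cm -!compA; congr comp; exact: beq.
have [K [[Ki Kj] _]] := proj2 HP _ _ _ cf.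
have Kq : K \o q = tru \o bang Q.
  apply: (is_po_inj HQ); rewrite -!compA.
    by rewrite ei compA Ki cm; congr comp; exact: beq.
  by rewrite ej compA Kj -compA; congr comp; exact: beq.
split=> // s u v uv.
(* [i \o u] factors through [q], on which [K] is true, so [chi \o u] is true and [u] lifts through
   [m]. *)
have [l [[lu _] _]] : exists! l : hom s w, m \o l = u /\ bw \o l = bang s.
  apply: U; rewrite -Ki -compA uv compA Kq -compA; congr comp; exact: beq.
exists l; split; last by move=> l' [l'u _]; apply: mm; rewrite lu.
by split=> //; apply: mq; rewrite compA ei -compA lu.
Qed.

(** The inverse images along the jointly epic [i] and [j] determine the classifier of a subobject of
    [P]. Equal classifiers make [v] factor through [k], and this factor inverts [th]. *)
Lemma topos_pushout_subobject_iso (C : category) (h y z P A B K V : C)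
    (f : hom h y) (g : hom h z) (i : hom y P) (j : hom z P)
    (k : hom K P) (v : hom V P) (th : hom K V)
    (a : hom A y) (aK : hom A K) (aV : hom A V)
    (b : hom B z) (bK : hom B K) (bV : hom B V) :
  is_topos C -> is_pushout f g i j -> is_mono k -> is_mono v ->
  is_pullback a aK i k -> is_pullback a aV i v ->
  is_pullback b bK j k -> is_pullback b bV j v ->
  v \o th = k -> is_iso th.
Proof.
move=> tC HP mk mv AK AV BK BV e.
have [_ [_ [t [om [tru [tP omP]]]]]] := tC.
have beq := terminal_eq tP.
have [ck [[bk Hk] _]] := omP _ _ _ mk.
have [cv [[bv Hv] _]] := omP _ _ _ mv.
(* Pasting of pullbacks: if [c] classifies [s], then [c \o r] classifies the inverse image of [s]
   along [r]. *)
have classifier_comp D S E (r : hom D P) (s : hom S P) c bs (d : hom E D)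
    (dS : hom E S) : is_pullback s bs c tru -> is_pullback d dS r s ->
    exists bE, is_pullback d bE (c \o r) tru.
  move=> Hs Hd; exists (bs \o dS); split.
    by rewrite -compA (proj1 Hd) !compA (proj1 Hs).
  move=> x p o ep; rewrite -compA in ep.
  have [p' [[p's p'b] _]] := proj2 Hs _ _ _ ep.
  have [l [[ld lS] Ul]] := proj2 Hd _ _ _ (eq_sym p's).
  exists l; split; first by split=> //; apply: beq.
  move=> l' [l'd _]; apply: Ul; split=> //.
  apply: (is_pb_inj Hs); last exact: beq.
  by rewrite p's compA -(proj1 Hd) -compA l'd.
have same D E (r : hom D P) (d : hom E D) dK dV :
    is_pullback d dK r k -> is_pullback d dV r v -> ck \o r = cv \o r.
  move=> DK DV.
  have md : is_mono d := pb_mono_fst DK mk.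
  have [ch [_ U]] := omP _ _ _ md.
  by rewrite -(U _ (classifier_comp _ _ _ _ _ _ _ _ _ Hk DK))
             -(U _ (classifier_comp _ _ _ _ _ _ _ _ _ Hv DV)).
have ec : ck = cv.
  by apply: (is_po_inj HP); [apply: same AK AV | apply: same BK BV].
have ev : ck \o v = tru \o bv by rewrite ec (proj1 Hv).
have [ht [[hv _] _]] := proj2 Hk _ _ _ ev.
exists ht; split.
  by apply: mk; rewrite compA hv e compm1.
by apply: mv; rewrite compA e hv compm1.
Qed.

(** * Composites computed on representatives *)

(** Since [hcell] respects isomorphism of cells, any chosen representatives describe the whole
    composite class; [vcomp_class] is the vertical counterpart. *)
Lemma hcomp_class (A X : category) (L : functor A X) (tX : is_topos X)
    (po : pushouts X) (a b c g h i : A)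
    (T : cospan L a b) (T' : cospan L b c) (B : cospan L g h)
    (B' : cospan L h i) (l : column L a g) (m : column L b h)
    (r : column L c i) (x : fine_rewrite T B l m)
    (x' : fine_rewrite T' B' m r) (s : cell T B l m) (s' : cell T' B' m r) :
  (forall q, x q <-> cell_iso s q) -> (forall q, x' q <-> cell_iso s' q) ->
  forall q, hcomp po tX x x' q <-> cell_iso (hcell po s s') q.
Proof.
move=> cs cs' q; split; last first.
  by exists s, s'; split; [|split=> //]; [apply/cs|apply/cs'];
    apply: cell_iso_refl.
move=> [u [u' [/cs e [/cs' e' eq]]]]; apply: cell_iso_trans eq.
exact: hcell_iso.
Qed.

Lemma vcomp_class (A X : category) (L : functor A X) (pb : pullbacks X)
    (a b g h a' b' : A) (T : cospan L a b) (M : cospan L g h)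
    (B : cospan L a' b') (l : column L a g) (r : column L b h)
    (l' : column L g a') (r' : column L h b')
    (pl : foot_pullback (col_down l) (col_up l'))
    (pr : foot_pullback (col_down r) (col_up r'))
    (x : fine_rewrite T M l r) (x' : fine_rewrite M B l' r')
    (s : cell T M l r) (s' : cell M B l' r') :
  (forall q, x q <-> cell_iso s q) -> (forall q, x' q <-> cell_iso s' q) ->
  forall q, vcomp pb pl pr x x' q <-> cell_iso (vcell pb pl pr s s') q.
Proof.
move=> cs cs' q; split; last first.
  by exists s, s'; split; [|split=> //]; [apply/cs|apply/cs'];
    apply: cell_iso_refl.
move=> [u [u' [/cs e [/cs' e' eq]]]]; apply: cell_iso_trans eq.
exact: vcell_iso.
Qed.

(** * Interchange for cells, then for their classes *)

Section Interchange.
Context (A X : category) (L : functor A X) (tX : is_topos X).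
Context (po : pushouts X) (pb : pullbacks X).
Context (a b c g h i a' b' c' : A).
Context (T1 : cospan L a b) (T2 : cospan L b c).
Context (M1 : cospan L g h) (M2 : cospan L h i).
Context (B1 : cospan L a' b') (B2 : cospan L b' c').
Context (l : column L a g) (m : column L b h) (r : column L c i).
Context (l' : column L g a') (m' : column L h b') (r' : column L i c').
Context (pl : foot_pullback (col_down l) (col_up l')).
Context (pm : foot_pullback (col_down m) (col_up m')).
Context (pr : foot_pullback (col_down r) (col_up r')).

(** The two universal properties give a map from the pushout of intersections to the intersection of
    pushouts. It lies over [P], where both are subobjects with the same inverse images, so it is
    invertible. *)
Lemma cell_interchange (s : cell T1 M1 l m) (s' : cell T2 M2 m r)
    (t : cell M1 B1 l' m') (t' : cell M2 B2 m' r') :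
  fine_cell s -> fine_cell s' -> fine_cell t -> fine_cell t' ->
  cell_iso (hcell po (vcell pb pl pm s t) (vcell pb pm pr s' t'))
           (vcell pb pl pr (hcell po s s') (hcell po t t')).
Proof.
move=> fs fs' ft ft'.
have fss := hcell_fine po tX fs fs'; have ftt := hcell_fine po tX ft ft'.
have [_ [_ [_ [i4 [_ m2]]]]] := fs; have [_ [_ [_ [_ [_ m2']]]]] := fs'.
have [_ [_ [j3 [_ [n1 _]]]]] := ft; have [_ [_ [_ [_ [n1' _]]]]] := ft'.
have [_ [_ [_ [_ [_ mq]]]]] := fss; have [_ [_ [_ [_ [mq' _]]]]] := ftt.
pose W := vcell pb pl pm s t; pose W' := vcell pb pm pr s' t'.
pose S := hcell po s s'; pose S' := hcell po t t'.
pose V := vcell pb pl pr S S'.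
pose P := po (csp_right M1) (csp_left M2).
pose K := po (mid_right W) (mid_left W').
pose Ps := po (mid_right s) (mid_left s').
pose Pt := po (mid_right t) (mid_left t').
pose VP := pb (mid_down S) (mid_up S').
have Sl : mid_down S \o po_inl Ps = po_inl P \o mid_down s by exact: po_copair_inl.
have Sr : mid_down S \o po_inr Ps = po_inr P \o mid_down s' by exact: po_copair_inr.
have S'l : mid_up S' \o po_inl Pt = po_inl P \o mid_up t by exact: po_copair_inl.
have S'r : mid_up S' \o po_inr Pt = po_inr P \o mid_up t' by exact: po_copair_inr.
pose w := pb (mid_down s) (mid_up t).
pose w' := pb (mid_down s') (mid_up t').
have el : mid_down S \o (po_inl Ps \o pb_fst w) =
          mid_up S' \o (po_inl Pt \o pb_snd w).
  by rewrite !compA Sl S'l -!compA pb_comm.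
have er : mid_down S \o (po_inr Ps \o pb_fst w') =
          mid_up S' \o (po_inr Pt \o pb_snd w').
  by rewrite !compA Sr S'r -!compA pb_comm.
pose cl : hom w VP := pb_pair VP el; pose cr : hom w' VP := pb_pair VP er.
(* On the shared foot, each projection of [VP] reduces the equation to the pushout square of [Ps] or
   [Pt]. *)
have ec : cl \o mid_right W = cr \o mid_left W'.
  apply: pb_inj; rewrite !compA ?pb_pair_fst ?pb_pair_snd -!compA /=
    ?pb_pair_fst ?pb_pair_snd !compA; congr comp; exact: po_comm.
pose th : hom K VP := po_copair K ec.
have thl : th \o po_inl K = cl by exact: po_copair_inl.
have thr : th \o po_inr K = cr by exact: po_copair_inr.
(* [v] includes [VP] in [P]; [kl] and [kr] exhibit [v \o th] as the map of pushouts induced by the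
   inclusions of [w] and [w']. *)
pose v := mid_down S \o pb_fst VP.
have kl : (v \o th) \o po_inl K = po_inl P \o (mid_down s \o pb_fst w).
  by rewrite -compA thl -compA pb_pair_fst !compA Sl.
have kr : (v \o th) \o po_inr K = po_inr P \o (mid_down s' \o pb_fst w').
  by rewrite -compA thr -compA pb_pair_fst !compA Sr.
(* [e] identifies the shared foot of the vertical composites with [L h]; its invertibility yields
   [mk] and the epi needed for the inverse images of [K]. *)
pose e := col_down m \o fp_fst pm.
have ie : is_iso e by apply: iso_comp => //; apply: pb_iso_fst (fpP pm) j3.
have fe : (mid_down s \o pb_fst w) \o mid_right W = csp_right M1 \o e.
  by rewrite -compA pb_pair_fst compA cell_dr -compA.
have ge : (mid_down s' \o pb_fst w') \o mid_left W' = csp_left M2 \o e.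
  by rewrite -compA pb_pair_fst compA cell_dl -compA.
have mw : is_mono (mid_down s \o pb_fst w).
  by apply: mono_comp m2 (pb_mono_fst (pbP w) n1).
have mw' : is_mono (mid_down s' \o pb_fst w').
  by apply: mono_comp m2' (pb_mono_fst (pbP w') n1').
have mk : is_mono (v \o th).
  exact: (topos_pushout_map_mono (po := po) tX ie mw mw' fe ge kl kr).
have mv : is_mono v by apply: mono_comp mq (pb_mono_fst (pbP VP) mq').
(* The four squares to check are the inverse images of [K] and then [VP], first along [po_inl P],
   then along [po_inr P]. *)
have ith : is_iso th.
{ apply: (topos_pushout_subobject_iso tX (poP P) mk mv
            (a := mid_down s \o pb_fst w) (aK := po_inl K) (aV := cl)
            (b := mid_down s' \o pb_fst w') (bK := po_inr K) (bV := cr)) => //.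
  - exact: (topos_pushout_map_pullback tX (poP K) (poP P) (iso_epi ie)
              mw mk (eq_sym fe) kl kr).
  (* Along [po_inl P] the inverse images of [Ps] and [Pt] are the central objects of [s] and [t],
     which intersect in [w]. *)
  - apply: (is_pb_meet (i1 := po_inl Ps) _ _ (pbP w) (pbP VP)).
    + exact: (topos_pushout_map_pullback tX (poP Ps) (poP P) (iso_epi i4)
                m2 mq (eq_sym (cell_dr s)) Sl Sr).
    + exact: (topos_pushout_map_pullback tX (poP Pt) (poP P) (iso_epi j3)
                n1 mq' (eq_sym (cell_ur t)) S'l S'r).
    + exact: pb_pair_fst.
    + exact: pb_pair_snd.
  - exact: (topos_pushout_map_pullback tX (is_po_sym (poP K))
              (is_po_sym (poP P)) (iso_epi ie) mw' mk (eq_sym ge) kr kl).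
  - apply: (is_pb_meet (i1 := po_inr Ps) _ _ (pbP w') (pbP VP)).
    + exact: (topos_pushout_map_pullback tX (is_po_sym (poP Ps))
                (is_po_sym (poP P)) (iso_epi i4) m2' mq
                (eq_sym (cell_dl s')) Sr Sl).
    + exact: (topos_pushout_map_pullback tX (is_po_sym (poP Pt))
                (is_po_sym (poP P)) (iso_epi j3) n1' mq'
                (eq_sym (cell_ul t')) S'r S'l).
    + exact: pb_pair_fst.
    + exact: pb_pair_snd. }
(* Arrows from the feet are compared on the projections of [VP], arrows to the central objects on
   the summands of [K]. *)
exists th; split=> //; split.
  rewrite /= compA thl; apply: pb_inj; rewrite compA ?pb_pair_fst ?pb_pair_snd.
    by rewrite -(compA _ (pb_fst w)) pb_pair_fst compA.
  by rewrite -(compA _ (pb_snd w)) pb_pair_snd compA.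
split.
  rewrite /= compA thr; apply: pb_inj; rewrite compA ?pb_pair_fst ?pb_pair_snd.
    by rewrite -(compA _ (pb_fst w')) pb_pair_fst compA.
  by rewrite -(compA _ (pb_snd w')) pb_pair_snd compA.
split; apply: po_inj.
- etransitivity; last by symmetry; exact: po_copair_inl.
  by rewrite -compA thl /= -compA pb_pair_fst !compA po_copair_inl.
- etransitivity; last by symmetry; exact: po_copair_inr.
  by rewrite -compA thr /= -compA pb_pair_fst !compA po_copair_inr.
- etransitivity; last by symmetry; exact: po_copair_inl.
  by rewrite -compA thl /= -compA pb_pair_snd !compA po_copair_inl.
- etransitivity; last by symmetry; exact: po_copair_inr.
  by rewrite -compA thr /= -compA pb_pair_snd !compA po_copair_inr.
Qed.

End Interchange.

Theorem theorem26 (A X : category) (L : functor A X) (R : functor X A)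
  (adj : adjunction L R) (tA : is_topos A) (tX : is_topos X)
  (Lpb : preserves_pullbacks L)
  (po : pushouts X) (pb : pullbacks X)
  (a b c g h i a' b' c' : A)
  (T1 : cospan L a b) (T2 : cospan L b c)
  (M1 : cospan L g h) (M2 : cospan L h i)
  (B1 : cospan L a' b') (B2 : cospan L b' c')
  (l : column L a g) (m : column L b h) (r : column L c i)
  (l' : column L g a') (m' : column L h b') (r' : column L i c')
  (pl : foot_pullback (col_down l) (col_up l'))
  (pm : foot_pullback (col_down m) (col_up m'))
  (pr : foot_pullback (col_down r) (col_up r'))
  (alpha : fine_rewrite T1 M1 l m) (alpha' : fine_rewrite T2 M2 m r)
  (beta : fine_rewrite M1 B1 l' m') (beta' : fine_rewrite M2 B2 m' r') :
  vcomp pb pl pr (hcomp po tX alpha alpha') (hcomp po tX beta beta')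
  = hcomp po tX (vcomp pb pl pm alpha beta) (vcomp pb pm pr alpha' beta').
Proof.
have [s [fs cs]] := fr_class alpha; have [s' [fs' cs']] := fr_class alpha'.
have [t [ft ct]] := fr_class beta; have [t' [ft' ct']] := fr_class beta'.
(* Each side is the class of one composite of the chosen representatives, so this single isomorphism
   identifies them. *)
have E := cell_interchange tX po pb pl pm pr fs fs' ft ft'.
have lhs := vcomp_class pb (pl := pl) (pr := pr)
  (hcomp_class (po := po) tX cs cs') (hcomp_class (po := po) tX ct ct').
have rhs := hcomp_class (po := po) tX
  (vcomp_class pb (pl := pl) (pr := pm) cs ct)
  (vcomp_class pb (pl := pm) (pr := pr) cs' ct').
apply: fine_rewrite_eq => q; split=> [/lhs e | /rhs e].
  by apply/rhs; apply: cell_iso_trans E e.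
by apply/lhs; apply: cell_iso_trans (cell_iso_sym E) e.
Qed.
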